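(* Let $P$ be a pair of pants (three-holed sphere) with $\pi_1(P)=\langle\gamma_1,\gamma_2,\gamma_3\mid\gamma_1\gamma_2\gamma_3=1\rangle$. Let $\rho:\pi_1(P)\to\mathrm{SL}(2,\mathbb{C})$ be an irreducible representation such that each $\rho(\gamma_i)$ has two fixed points $x_i,y_i$ on $\mathbb{C}P^1$, and let $e_i$ be the eigenvalue of $\rho(\gamma_i)$ corresponding to $x_i$. Then $\rho$ is described only in terms of the $e_i$ and $x_i$: for $i=1,2,3$ (indices mod $3$), $$\rho(\gamma_i)=\frac{1}{e_ie_{i+1}(x_{i+1}-x_i)(x_{i+2}-x_i)}\begin{pmatrix} a_{11} & a_{12} \\ a_{21} & a_{22} \end{pmatrix},$$ $$\begin{aligned} a_{11}&=e_i^2e_{i+1}x_i(x_i-x_{i+2})+e_{i+1}x_{i+2}(x_{i+1}-x_i)+e_ie_{i+2}x_i(x_{i+2}-x_{i+1}), \\ a_{12}&=x_i\bigl(e_i^2e_{i+1}x_{i+1}(x_{i+2}-x_i)+e_{i+1}x_{i+2}(x_i-x_{i+1})+e_ie_{i+2}x_i(x_{i+1}-x_{i+2})\bigr), \\ a_{21}&=e_i^2e_{i+1}(x_i-x_{i+2})+e_{i+1}(x_{i+1}-x_i)+e_ie_{i+2}(x_{i+2}-x_{i+1}), \\ a_{22}&=e_i^2e_{i+1}x_{i+1}(x_{i+2}-x_i)+e_{i+1}x_i(x_i-x_{i+1})+e_ie_{i+2}x_i(x_{i+1}-x_{i+2}). \end{aligned}$$ The other fixed point $y_i$ of $\rho(\gamma_i)$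 (corresponding to $e_i^{-1}$) is $$y_i=\frac{e_i^2e_{i+1}x_{i+1}(x_i-x_{i+2})+e_{i+1}x_{i+2}(x_{i+1}-x_i)+e_ie_{i+2}x_i(x_{i+2}-x_{i+1})}{e_i^2e_{i+1}(x_i-x_{i+2})+e_{i+1}(x_{i+1}-x_i)+e_ie_{i+2}(x_{i+2}-x_{i+1})}.$$
   Context: A matrix acts on $\mathbb{C}P^1=\mathbb{C}\cup\{\infty\}$ by M\''obius transformations; the fixed point corresponding to an eigenvalue is the projective class of its eigenvector ($(z,1)^T\leftrightarrow z$). A representation is irreducible if its image has no common fixed point on $\mathbb{C}P^1$. If one of the $x_i$ is $\infty$ the formulas are understood by the usual limits. *)

(* Defs.v *)
From HB Require Import structures.
From mathcomp Require Import all_boot all_order all_algebra.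
From mathcomp Require Import all_classical all_reals all_analysis.
From mathcomp Require Import complex.

Set Implicit Arguments.
Unset Strict Implicit.
Unset Printing Implicit Defensive.

Import Order.TTheory GRing.Theory Num.Theory.
Import numFieldNormedType.Exports.

Local Open Scope classical_set_scope.
Local Open Scope ring_scope.
Local Open Scope quotient_scope.

(* Indices live in 'Z_3, so that [i + 1] and [i + 2] are taken mod 3; the
   index 3 is the element [3 = 0]. *)

(* The group < g_1, g_2, g_3 | g_1 g_2 g_3 = 1 >, as words modulo the
   congruence generated by free cancellation and by the relator.  The letter
   (i, false) stands for g_i and the letter (i, true) for its inverse. *)
Definition pants_letter : Type := ('Z_3 * bool)%type.
Definition pants_word : Type := seq pants_letter.

Definition inv_letter (l : pants_letter) : pants_letter := (l.1, ~~ l.2).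
Definition inv_word (w : pants_word) : pants_word := rev (map inv_letter w).

Definition pants_relator : pants_word :=
  [:: (1, false); (2, false); (3, false)].

Inductive pants_eq : pants_word -> pants_word -> Prop :=
| pants_eq_refl u : pants_eq u u
| pants_eq_sym u v : pants_eq u v -> pants_eq v u
| pants_eq_trans v u w : pants_eq u v -> pants_eq v w -> pants_eq u w
| pants_eq_cancel u v l : pants_eq (u ++ l :: inv_letter l :: v) (u ++ v)
| pants_eq_relator u v : pants_eq (u ++ pants_relator ++ v) (u ++ v).

Definition pants_eqb : rel pants_word := fun u v => `[< pants_eq u v >].

Fact pants_eqb_refl : reflexive pants_eqb.
Proof. by move=> u; apply/asboolP; exact: pants_eq_refl. Qed.

Fact pants_eqb_sym : symmetric pants_eqb.
Proof. by move=> u v; apply/asboolP/asboolP; exact: pants_eq_sym. Qed.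

Fact pants_eqb_trans : transitive pants_eqb.
Proof.
move=> v u w /asboolP uv /asboolP vw.
by apply/asboolP; exact: pants_eq_trans uv vw.
Qed.

Canonical pants_equiv :=
  EquivRel pants_eqb pants_eqb_refl pants_eqb_sym pants_eqb_trans.

Definition pants_group : Type := {eq_quot pants_equiv}.
HB.instance Definition _ := Choice.on pants_group.
HB.instance Definition _ := EqQuotient.on pants_group.

Section PantsGroup.

Implicit Types u v w : pants_word.

Definition pants_class u : pants_group := \pi_pants_group u.

Lemma pants_classP u v : pants_eq u v <-> pants_class u = pants_class v.
Proof.
split=> [uv|/eqmodP/asboolP //].
by apply/eqmodP/asboolP.
Qed.

Lemma pants_repr (a : pants_group) : exists u, a = pants_class u.
Proof. by exists (repr a); rewrite /pants_class reprK. Qed.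

Lemma pants_reprE u : pants_eq (repr (pants_class u)) u.
Proof. by apply/pants_classP; rewrite /pants_class reprK. Qed.

Lemma pants_eq_catl a u v : pants_eq u v -> pants_eq (a ++ u) (a ++ v).
Proof.
elim=> {u v}.
- by move=> u; exact: pants_eq_refl.
- by move=> u v _; exact: pants_eq_sym.
- by move=> v u w _ uv _; exact: pants_eq_trans.
- by move=> u v l; rewrite !catA; exact: pants_eq_cancel.
- by move=> u v; rewrite catA [X in pants_eq _ X]catA; exact: pants_eq_relator.
Qed.

Lemma pants_eq_catr a u v : pants_eq u v -> pants_eq (u ++ a) (v ++ a).
Proof.
elim=> {u v}.
- by move=> u; exact: pants_eq_refl.
- by move=> u v _; exact: pants_eq_sym.
- by move=> v u w _ uv _; exact: pants_eq_trans.
- by move=> u v l; rewrite -!catA; exact: pants_eq_cancel.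
- by move=> u v; rewrite -!catA; exact: pants_eq_relator.
Qed.

Lemma pants_eq_cat u u' v v' :
  pants_eq u u' -> pants_eq v v' -> pants_eq (u ++ v) (u' ++ v').
Proof.
move=> uu vv; apply: (pants_eq_trans (v := u' ++ v)).
  exact: pants_eq_catr.
exact: pants_eq_catl.
Qed.

Lemma inv_letterK : involutive inv_letter.
Proof. by case=> i b; rewrite /inv_letter negbK. Qed.

Lemma inv_wordK : involutive inv_word.
Proof.
move=> w; rewrite /inv_word map_rev revK -map_comp.
by apply: map_id_in => l _; exact: inv_letterK.
Qed.

Lemma inv_word_cat u v : inv_word (u ++ v) = inv_word v ++ inv_word u.
Proof. by rewrite /inv_word map_cat rev_cat. Qed.

Lemma pants_eq_mulV u : pants_eq (u ++ inv_word u) [::].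
Proof.
elim/last_ind: u => [|u l ih]; first exact: pants_eq_refl.
rewrite -cats1 inv_word_cat -catA /=.
exact: pants_eq_trans (pants_eq_cancel _ _ _) ih.
Qed.

Lemma pants_eq_Vmul u : pants_eq (inv_word u ++ u) [::].
Proof. by rewrite -{2}[u]inv_wordK; exact: pants_eq_mulV. Qed.

Lemma pants_eq_inv u v : pants_eq u v -> pants_eq (inv_word u) (inv_word v).
Proof.
move=> uv; apply: (pants_eq_trans (v := inv_word u ++ (v ++ inv_word v))).
  apply: pants_eq_sym; rewrite -[X in pants_eq _ X]cats0.
  exact/pants_eq_catl/pants_eq_mulV.
rewrite catA -[X in pants_eq _ X]cat0s; apply: pants_eq_catr.
apply: pants_eq_trans (pants_eq_Vmul u).
exact/pants_eq_catl/pants_eq_sym.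
Qed.

Definition pants_one : pants_group := pants_class [::].
Definition pants_mul (a b : pants_group) : pants_group :=
  pants_class (repr a ++ repr b).
Definition pants_inv (a : pants_group) : pants_group :=
  pants_class (inv_word (repr a)).

Lemma pants_mulE u v :
  pants_mul (pants_class u) (pants_class v) = pants_class (u ++ v).
Proof. by apply/pants_classP/pants_eq_cat; exact: pants_reprE. Qed.

Lemma pants_invE u : pants_inv (pants_class u) = pants_class (inv_word u).
Proof. by apply/pants_classP/pants_eq_inv; exact: pants_reprE. Qed.

Fact pants_mulA : associative pants_mul.
Proof.
move=> a b c; have [u ->] := pants_repr a; have [v ->] := pants_repr b.
by have [w ->] := pants_repr c; rewrite !pants_mulE catA.
Qed.

Fact pants_mul1 : left_id pants_one pants_mul.
Proof. by move=> a; have [u ->] := pants_repr a; rewrite pants_mulE. Qed.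

Fact pants_mulr1 : right_id pants_one pants_mul.
Proof. by move=> a; have [u ->] := pants_repr a; rewrite pants_mulE cats0. Qed.

Fact pants_mulV : left_inverse pants_one pants_inv pants_mul.
Proof.
move=> a; have [u ->] := pants_repr a; rewrite pants_invE pants_mulE.
exact/pants_classP/pants_eq_Vmul.
Qed.

Fact pants_mulrV : right_inverse pants_one pants_inv pants_mul.
Proof.
move=> a; have [u ->] := pants_repr a; rewrite pants_invE pants_mulE.
exact/pants_classP/pants_eq_mulV.
Qed.

HB.instance Definition _ := isGroup.Build pants_group
  pants_mulA pants_mul1 pants_mulr1 pants_mulV pants_mulrV.

Definition pants_gen (i : 'Z_3) : pants_group := pants_class [:: (i, false)].

Lemma pants_gen_rel : (pants_gen 1%R * pants_gen 2%R * pants_gen 3%R = 1)%g.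
Proof.
have mulE u v : (pants_class u * pants_class v)%g = pants_class (u ++ v).
  exact: pants_mulE.
rewrite /pants_gen !mulE; apply/pants_classP.
exact: (pants_eq_relator [::] [::]).
Qed.

End PantsGroup.

Section SpecialLinear.
Variable K : fieldType.

Definition SL2 : Type := {A : 'M[K]_2 | \det A == 1}.
HB.instance Definition _ := [isSub for @sval _ _ : SL2 -> 'M[K]_2].
HB.instance Definition _ := [Choice of SL2 by <:].

Definition SL2_mx (A : SL2) : 'M[K]_2 := val A.

Fact SL2_one_subproof : \det (1%:M : 'M[K]_2) == 1.
Proof. by rewrite det1. Qed.
Definition SL2_one : SL2 := Sub 1%:M SL2_one_subproof.

Fact SL2_mul_subproof (A B : SL2) : \det (val A *m val B) == 1.
Proof. by rewrite det_mulmx (eqP (valP A)) (eqP (valP B)) mulr1. Qed.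
Definition SL2_mul (A B : SL2) : SL2 := Sub (val A *m val B) (SL2_mul_subproof A B).

Fact SL2_inv_subproof (A : SL2) : \det (invmx (val A)) == 1.
Proof. by rewrite det_inv (eqP (valP A)) invr1. Qed.
Definition SL2_inv (A : SL2) : SL2 := Sub (invmx (val A)) (SL2_inv_subproof A).

Fact SL2_unitmx (A : SL2) : val A \in unitmx.
Proof. by rewrite unitmxE (eqP (valP A)) unitr1. Qed.

Fact SL2_mulA : associative SL2_mul.
Proof. by move=> A B D; apply: val_inj; rewrite /= mulmxA. Qed.
Fact SL2_mul1 : left_id SL2_one SL2_mul.
Proof. by move=> A; apply: val_inj; rewrite /= mul1mx. Qed.
Fact SL2_mulr1 : right_id SL2_one SL2_mul.
Proof. by move=> A; apply: val_inj; rewrite /= mulmx1. Qed.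
Fact SL2_mulV : left_inverse SL2_one SL2_inv SL2_mul.
Proof. by move=> A; apply: val_inj; rewrite /= mulVmx ?SL2_unitmx. Qed.
Fact SL2_mulrV : right_inverse SL2_one SL2_inv SL2_mul.
Proof. by move=> A; apply: val_inj; rewrite /= mulmxV ?SL2_unitmx. Qed.

HB.instance Definition _ := isGroup.Build SL2
  SL2_mulA SL2_mul1 SL2_mulr1 SL2_mulV SL2_mulrV.

End SpecialLinear.

(* R[i] as a canonical numClosedFieldType: this is the form under which the
   analysis library puts on it the topology of the complex modulus. *)
Definition Cplx (R : realType) : numClosedFieldType := R[i].

Section ProjectiveLine.
Variable K : numClosedFieldType.

(* [None] is the point at infinity. *)
Definition CP1 : Type := one_point_compactification K.
HB.instance Definition _ := Topological.on CP1.

Definition mx22 (a b c d : K) : 'M[K]_2 :=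
  \matrix_(r, s) (if r == 0 then if s == 0 then a else b
                  else if s == 0 then c else d).

(* The projective class of the vector (p, q)^T; the junk case p = q = 0 is
   always excluded separately below. *)
Definition cp1_quot (p q : K) : CP1 := if q == 0 then None else Some (p / q).

Definition cp1_vec (p : CP1) : 'cV[K]_2 :=
  \col_r (if p is Some z then if r == 0 then z else 1
          else if r == 0 then 1 else 0).

Definition mobius (A : 'M[K]_2) (p : CP1) : CP1 :=
  if p is Some z then cp1_quot (A 0 0 * z + A 0 1) (A 1 0 * z + A 1 1)
  else cp1_quot (A 0 0) (A 1 0).

Definition fixed_points (A : 'M[K]_2) : set CP1 := [set p | mobius A p = p].

Definition irreducible_rep (G : groupType) (rho : {multiplicative G -> SL2 K}) :=
  ~ exists p, forall g, fixed_points (SL2_mx (rho g)) p.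

(* The affine coordinates of the points x_k, with z substituted for infinity. *)
Definition affine_coords (x : 'Z_3 -> CP1) (z : K) : 'Z_3 -> K :=
  fun k => if x k is Some t then t else z.

(* The formula F, meaningful on D, takes the value l at x: if all the x_k are
   finite this is plain evaluation; otherwise it is the limit as the infinite
   coordinate, written w^-1, goes to infinity. *)
Definition formula_value (T : topologicalType) (D : set ('Z_3 -> K))
    (F : ('Z_3 -> K) -> T) (x : 'Z_3 -> CP1) (l : T) : Prop :=
  if [exists k, x k == None] then
    (\forall w \near 0^', D (affine_coords x w^-1)) /\
    F (affine_coords x w^-1) @[w --> 0^'] --> l
  else D (affine_coords x 0) /\ F (affine_coords x 0) = l.

Section Formulas.
Variables (e x : 'Z_3 -> K) (i : 'Z_3).

Definition pants_den : K :=
  e i * e (i + 1) * (x (i + 1) - x i) * (x (i + 2) - x i).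

Definition pants_a11 : K :=
  e i ^+ 2 * e (i + 1) * x i * (x i - x (i + 2))
  + e (i + 1) * x (i + 2) * (x (i + 1) - x i)
  + e i * e (i + 2) * x i * (x (i + 2) - x (i + 1)).

Definition pants_a12 : K :=
  x i * (e i ^+ 2 * e (i + 1) * x (i + 1) * (x (i + 2) - x i)
         + e (i + 1) * x (i + 2) * (x i - x (i + 1))
         + e i * e (i + 2) * x i * (x (i + 1) - x (i + 2))).

Definition pants_a21 : K :=
  e i ^+ 2 * e (i + 1) * (x i - x (i + 2))
  + e (i + 1) * (x (i + 1) - x i)
  + e i * e (i + 2) * (x (i + 2) - x (i + 1)).

Definition pants_a22 : K :=
  e i ^+ 2 * e (i + 1) * x (i + 1) * (x (i + 2) - x i)
  + e (i + 1) * x i * (x i - x (i + 1))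
  + e i * e (i + 2) * x i * (x (i + 1) - x (i + 2)).

Definition pants_mx : 'M[K]_2 :=
  pants_den^-1 *: mx22 pants_a11 pants_a12 pants_a21 pants_a22.

Definition pants_ynum : K :=
  e i ^+ 2 * e (i + 1) * x (i + 1) * (x i - x (i + 2))
  + e (i + 1) * x (i + 2) * (x (i + 1) - x i)
  + e i * e (i + 2) * x i * (x (i + 2) - x (i + 1)).

Definition pants_yden : K :=
  e i ^+ 2 * e (i + 1) * (x i - x (i + 2))
  + e (i + 1) * (x (i + 1) - x i)
  + e i * e (i + 2) * (x (i + 2) - x (i + 1)).

End Formulas.

End ProjectiveLine.

(* Main.v *)
Require Import Defs.
From HB Require Import structures.
From mathcomp Require Import all_boot all_order all_algebra.
From mathcomp Require Import all_classical all_reals all_analysis.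
From mathcomp Require Import complex ring.
Import Order.TTheory GRing.Theory Num.Theory.
Import numFieldNormedType.Exports.
Local Open Scope classical_set_scope.
Local Open Scope ring_scope.

(* Write A_i for the image of the i-th generator, v_i for an eigenvector over
   x_i and w(u, v) for the determinant form, which SL2 preserves.  Then
     A_i v_i = e_i v_i,
     e_i w(v_i, A_i v_{i+1}) = w(v_i, v_{i+1}),
     e_{i+1} w(v_{i+2}, A_i v_{i+1}) = e_{i+2} w(v_{i+2}, v_{i+1}),
   the last one because A_{i+2} A_i A_{i+1} = 1.  By irreducibility the x_i are
   distinct, so these four linear equations determine A_i; solving them gives
   the matrix formula in homogeneous coordinates.  The vector Y_i made of the
   numerator and denominator of the formula for y_i is nonzero, and both Y_i and
   y_i are eigenvectors for e_i^-1; since e_i^2 != 1, invariance of w forces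
   w(y_i, Y_i) = 0.  A point at infinity is (1 : 0), approached by (1 : t) as
   t tends to 0, and the homogeneous formulas are continuous there. *)

Set Implicit Arguments.
Unset Strict Implicit.

(** * Convergence of matrices and of points of the projective line *)

Lemma cvg_mx (T : topologicalType) (m n : nat) (U : Type) (F : set_system U)
    (FF : Filter F) (f : U -> 'M[T]_(m, n)) (A : 'M[T]_(m, n)) :
  (forall i j, f u i j @[u --> F] --> A i j) -> f @ F --> A.
Proof.
move=> fA V [P PA PV].
have : \forall u \near F, forall i j, P i j (f u i j).
  by apply: filter_forall => i; apply: filter_forall => j; exact: fA (PA i j).
by apply: filterS => u Pu; exact: PV.
Qed.

(** At a finite limit this is continuity of division and of the embedding of [K]; at infinity it
    rests on neighbourhoods containing complements of compact sets. *)
Lemma cvg_cp1_quot (K : numClosedFieldType) (T : Type) (F : set_system T)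
    (FF : Filter F) (n d : T -> K) (a b : K) :
  n @ F --> a -> d @ F --> b -> (a, b) != (0, 0) ->
  cp1_quot (n t) (d t) @[t --> F] --> cp1_quot a b.
Proof.
move=> na db ab0; rewrite /cp1_quot.
have [b0|b0] := eqVneq b 0; last first.
  have dn0 : \forall t \near F, d t != 0.
    exact: (@cvgr_neq0 K (K : numFieldType) T F FF d b db b0).
  have : Some (n t / d t) @[t --> F] --> (Some (a / b) : CP1 K).
    apply: (@cvg_comp _ _ _ (fun t => n t / d t) (Some : K -> CP1 K)).
      exact: (@cvgM K T F FF n _ a _ na (@cvgV K T F FF d b b0 db)).
    exact: one_point_compactification_some_continuous.
  apply: cvg_trans; apply: near_eq_cvg.
  by apply: filterS dn0 => t dt; rewrite ifN.
move: db ab0; rewrite b0 => db ab0.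
have a0 : a != 0 by apply: contraNneq ab0 => ->.
move=> U [C [Cc _] CU].
(* [n - z d] tends to [a != 0] locally uniformly in [z], so by compactness it
   is eventually nonzero for all [z] in [C] at once, i.e. [n / d] leaves [C]. *)
have Cn : forall z, C z ->
    \forall z' \near z & t \near F, (n t - z' * d t) != 0.
  move=> z _.
  have h : (fun q : K * T => n q.2 - q.1 * d q.2) @ filter_prod (nbhs z) F --> a.
    have nq : (fun q : K * T => n q.2) @ filter_prod (nbhs z) F --> a.
      exact: (@cvg_comp _ _ _ snd n _ _ _ cvg_snd na).
    have dq : (fun q : K * T => d q.2) @ filter_prod (nbhs z) F --> (0 : K).
      exact: (@cvg_comp _ _ _ snd d _ _ _ cvg_snd db).
    have zq : (fun q : K * T => q.1) @ filter_prod (nbhs z) F --> z.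
      exact: cvg_fst.
    have := @cvgB K (K : numFieldType) _ _ _ _ _ _ _ nq (@cvgM K _ _ _ _ _ _ _ zq dq).
    by rewrite mulr0 subr0; exact.
  exact: (@cvgr_neq0 K (K : numFieldType) _ _ _ _ _ h a0).
move/compact_near_coveringP : Cc => /(_ T F (fun t z => n t - z * d t != 0)).
move=> /(_ FF Cn); apply: filterS => t tC; apply: CU.
case: eqVneq => dt; [by right|left].
exists (n t / d t) => // Ct; have := tC _ Ct.
by rewrite divfK// subrr eqxx.
Qed.

(** * The formulas in homogeneous coordinates *)

Section Homogeneous.
Variable K : numClosedFieldType.

Lemma cp1_quotMr (a b c : K) : c != 0 -> cp1_quot (a / c) (b / c) = cp1_quot a b.
Proof.
move=> c0; rewrite /cp1_quot mulf_eq0 invr_eq0 (negPf c0) orbF.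
by case: eqVneq => // b0; congr Some; field; rewrite b0.
Qed.

(* The formulas of [Section Formulas] with [x k] replaced by the homogeneous
   coordinates [(p k : q k)] and denominators cleared. *)
Section Coordinates.
Variables (e p q : 'Z_3 -> K) (i : 'Z_3).

(** Divided by [q j * q k] it is a difference of affine coordinates, so it stands for
    [x j - x k]. *)
Definition bracket (j k : 'Z_3) : K := p j * q k - p k * q j.

Definition hden : K :=
  e i * e (i + 1) * bracket (i + 1) i * bracket (i + 2) i.

Definition hynum : K :=
  e i ^+ 2 * e (i + 1) * p (i + 1) * bracket i (i + 2)
  + e (i + 1) * p (i + 2) * bracket (i + 1) i
  + e i * e (i + 2) * p i * bracket (i + 2) (i + 1).

Definition hyden : K :=
  e i ^+ 2 * e (i + 1) * q (i + 1) * bracket i (i + 2)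
  + e (i + 1) * q (i + 2) * bracket (i + 1) i
  + e i * e (i + 2) * q i * bracket (i + 2) (i + 1).

Definition ha11 : K :=
  e i ^+ 2 * e (i + 1) * p i * q (i + 1) * bracket i (i + 2)
  + e (i + 1) * q i * p (i + 2) * bracket (i + 1) i
  + e i * e (i + 2) * p i * q i * bracket (i + 2) (i + 1).

Definition ha22 : K :=
  e i ^+ 2 * e (i + 1) * p (i + 1) * q i * bracket (i + 2) i
  + e (i + 1) * p i * q (i + 2) * bracket i (i + 1)
  + e i * e (i + 2) * p i * q i * bracket (i + 1) (i + 2).

(** The off-diagonal entries reuse [hynum] and [hyden] because the fixed points of a Möbius map
    multiply to minus the ratio of these entries. *)
Definition hmx : 'M[K]_2 :=
  hden^-1 *: mx22 ha11 (- (p i * hynum)) (q i * hyden) ha22.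

Section Affine.
Hypothesis q_neq0 : forall k, q k != 0.
Let z k := p k / q k.

Lemma pants_den_quot :
  pants_den e z i = hden / (q i ^+ 2 * q (i + 1) * q (i + 2)).
Proof. by rewrite /pants_den /hden /bracket /z; field; rewrite !q_neq0. Qed.

Lemma pants_ynum_quot :
  pants_ynum e z i = hynum / (q i * q (i + 1) * q (i + 2)).
Proof. by rewrite /pants_ynum /hynum /bracket /z; field; rewrite !q_neq0. Qed.

Lemma pants_yden_quot :
  pants_yden e z i = hyden / (q i * q (i + 1) * q (i + 2)).
Proof. by rewrite /pants_yden /hyden /bracket /z; field; rewrite !q_neq0. Qed.

Lemma pants_mx_quot : pants_mx e z i = hmx.
Proof.
rewrite /pants_mx pants_den_quot /hmx; set s := q i ^+ 2 * _ * _.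
have s0 : s != 0 by rewrite /s !mulf_neq0 ?expf_neq0.
(* The factor [s] is moved inside, where it clears the denominators of the entries. *)
rewrite invf_div mulrC -scalerA; congr (_ *: _).
by apply/matrixP => r c; rewrite !mxE; case: ifP; case: ifP => _ _;
  rewrite /s /pants_a11 /pants_a12 /pants_a21 /pants_a22 /ha11 /ha22
    /hynum /hyden /bracket /z; field; rewrite !q_neq0.
Qed.

Lemma cp1_quot_quot :
  cp1_quot (pants_ynum e z i) (pants_yden e z i) = cp1_quot hynum hyden.
Proof. by rewrite pants_ynum_quot pants_yden_quot cp1_quotMr// !mulf_neq0. Qed.

End Affine.
End Coordinates.
End Homogeneous.

(** * Solving the linear equations for a generator *)

Section Algebra.
Variable K : fieldType.

(* The solution of the four linear equations for the entries [a b c d]. *)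
Lemma coord_of_area (e0 e1 e2 p0 q0 p1 q1 p2 q2 a b c d : K) :
  a * p0 + b * q0 = e0 * p0 -> c * p0 + d * q0 = e0 * q0 ->
  e0 * (p0 * (c * p1 + d * q1) - (a * p1 + b * q1) * q0) = p0 * q1 - p1 * q0 ->
  e1 * (p2 * (c * p1 + d * q1) - (a * p1 + b * q1) * q2)
    = e2 * (p2 * q1 - p1 * q2) ->
  let D := e0 * e1 * (p1 * q0 - p0 * q1) * (p2 * q0 - p0 * q2) in
  let Y := e0 ^+ 2 * e1 * p1 * (p0 * q2 - p2 * q0)
    + e1 * p2 * (p1 * q0 - p0 * q1) + e0 * e2 * p0 * (p2 * q1 - p1 * q2) in
  let X := e0 ^+ 2 * e1 * q1 * (p0 * q2 - p2 * q0)
    + e1 * q2 * (p1 * q0 - p0 * q1) + e0 * e2 * q0 * (p2 * q1 - p1 * q2) in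
  [/\ D * a = e0 ^+ 2 * e1 * p0 * q1 * (p0 * q2 - p2 * q0)
        + e1 * q0 * p2 * (p1 * q0 - p0 * q1)
        + e0 * e2 * p0 * q0 * (p2 * q1 - p1 * q2),
      D * b = - (p0 * Y), D * c = q0 * X
    & D * d = e0 ^+ 2 * e1 * p1 * q0 * (p2 * q0 - p0 * q2)
        + e1 * p0 * q2 * (p0 * q1 - p1 * q0)
        + e0 * e2 * p0 * q0 * (p1 * q2 - p2 * q1)].
Proof.
move=> H1 H2 H3 H4 /=.
(* [(al, be)] is the image of [(p1, q1)]. [H3] and [H4] give its determinants with [(p0, q0)] and
   [(p2, q2)], so Cramer's rule recovers it. *)
set al := a * p1 + b * q1 in H3 H4; set be := c * p1 + d * q1 in H3 H4.
have Ea : e0 * e1 * (p2 * q0 - p0 * q2) * al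
    = e0 * e2 * p0 * (p2 * q1 - p1 * q2) - e1 * p2 * (p0 * q1 - p1 * q0).
  transitivity (e0 * p0 * (e1 * (p2 * be - al * q2))
     - e1 * p2 * (e0 * (p0 * be - al * q0))); first by ring.
  by rewrite H3 H4; ring.
have Eb : e0 * e1 * (p2 * q0 - p0 * q2) * be
    = e0 * e2 * q0 * (p2 * q1 - p1 * q2) - e1 * q2 * (p0 * q1 - p1 * q0).
  transitivity (e0 * q0 * (e1 * (p2 * be - al * q2))
     - e1 * q2 * (e0 * (p0 * be - al * q0))); first by ring.
  by rewrite H3 H4; ring.
set S := e0 * e1 * (p2 * q0 - p0 * q2) in Ea Eb.
have DE : e0 * e1 * (p1 * q0 - p0 * q1) * (p2 * q0 - p0 * q2)
  = S * (p1 * q0 - p0 * q1) by rewrite /S; ring.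
rewrite !DE; split.
(* Cramer's rule again: each row of the matrix is found from its values at [(p0, q0)] and
   [(p1, q1)]. *)
- transitivity (q0 * (S * al) - S * q1 * (a * p0 + b * q0)); first by rewrite /al; ring.
  by rewrite Ea H1 /S; ring.
- transitivity (S * p1 * (a * p0 + b * q0) - p0 * (S * al)); first by rewrite /al; ring.
  by rewrite Ea H1 /S; ring.
- transitivity (q0 * (S * be) - S * q1 * (c * p0 + d * q0)); first by rewrite /be; ring.
  by rewrite Eb H2 /S; ring.
- transitivity (S * p1 * (c * p0 + d * q0) - p0 * (S * be)); first by rewrite /be; ring.
  by rewrite Eb H2 /S; ring.
Qed.
End Algebra.

(** * Continuity in the second homogeneous coordinates, the first ones being fixed *)

Section Continuity.
Variables (K : numClosedFieldType) (T : Type) (F : set_system T).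
Hypothesis FF : Filter F.

Let cM (f g : T -> K) (a b : K) :
  f @ F --> a -> g @ F --> b -> f t * g t @[t --> F] --> a * b.
Proof. exact: cvgM. Qed.

Let cD (f g : T -> K) (a b : K) :
  f @ F --> a -> g @ F --> b -> f t + g t @[t --> F] --> a + b.
Proof. exact: (@cvgD K (K : numFieldType)). Qed.

Let cN (f : T -> K) (a : K) : f @ F --> a -> - f t @[t --> F] --> - a.
Proof. exact: (@cvgN K (K : numFieldType)). Qed.

Let cC (a : K) : (fun=> a) @ F --> a.
Proof. exact: cvg_cst. Qed.

Variables (e p : 'Z_3 -> K) (i : 'Z_3) (q : T -> 'Z_3 -> K) (q0 : 'Z_3 -> K).
Hypothesis qq0 : forall k, q t k @[t --> F] --> q0 k.

Ltac cvg_polynomial := repeat first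
  [exact: cC | exact: qq0 | apply: cD | apply: cM | apply: cN].

Lemma cvg_hden : hden e p (q t) i @[t --> F] --> hden e p q0 i.
Proof. by rewrite /hden /bracket; cvg_polynomial. Qed.

Lemma cvg_hynum : hynum e p (q t) i @[t --> F] --> hynum e p q0 i.
Proof. by rewrite /hynum /bracket; cvg_polynomial. Qed.

Lemma cvg_hyden : hyden e p (q t) i @[t --> F] --> hyden e p q0 i.
Proof. by rewrite /hyden /bracket; cvg_polynomial. Qed.

Lemma cvg_hmx : hden e p q0 i != 0 ->
  hmx e p (q t) i @[t --> F] --> hmx e p q0 i.
Proof.
move=> D0; apply: cvg_mx => r c; rewrite !mxE.
under eq_fun do rewrite !mxE.
apply: cM; first exact: (@cvgV K _ _ _ _ _ D0 cvg_hden).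
case: ifP => _; case: ifP => _; rewrite /ha11 /ha22 /bracket; cvg_polynomial.
Qed.

End Continuity.

(** * Values of a formula at points that may be infinite *)

Section Limits.
Variables (K : numClosedFieldType) (x : 'Z_3 -> CP1 K).

(* [x k = (hnum k : hdenom 0 k)]; for [w != 0], [hnum k / hdenom w k] is
   [affine_coords x w^-1 k]. *)
Definition hnum (k : 'Z_3) : K := if x k is Some z then z else 1.
Definition hdenom (w : K) (k : 'Z_3) : K := if x k is Some _ then 1 else w.

Lemma cvg_hdenom k : hdenom w k @[w --> (0 : K)] --> hdenom 0 k.
Proof.
rewrite /hdenom; case: (x k) => [z|].
  apply: (@cvg_cst K 1 K (nbhs (0 : K))).
exact: cvg_id.
Qed.

(** For small [w != 0] the affine and homogeneous formulas agree; the latter is assumed continuous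
    at [w = 0], so its value there is the required limit. *)
Lemma formula_value_homogeneous (T : topologicalType) (D : set ('Z_3 -> K))
    (F : ('Z_3 -> K) -> T) (Dh : ('Z_3 -> K) -> ('Z_3 -> K) -> Prop)
    (Fh : ('Z_3 -> K) -> ('Z_3 -> K) -> T) :
  (forall p q, (forall k, q k != 0) -> F (fun k => p k / q k) = Fh p q) ->
  (forall p q, (forall k, q k != 0) -> Dh p q -> D (fun k => p k / q k)) ->
  (\forall w \near (0 : K), Dh hnum (hdenom w)) ->
  Fh hnum (hdenom w) @[w --> (0 : K)] --> Fh hnum (hdenom 0) ->
  formula_value D F x (Fh hnum (hdenom 0)).
Proof.
move=> FE DE Dnear Fcvg; rewrite /formula_value.
case: existsP => [_|xfin].
  have coordE w : w != 0 ->
      affine_coords x w^-1 = (fun k => hnum k / hdenom w k) /\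
      forall k, hdenom w k != 0.
    move=> w0; split=> [|k]; last by rewrite /hdenom; case: (x k) => //= *; rewrite oner_neq0.
    apply/funext => k; rewrite /affine_coords /hnum /hdenom.
    by case: (x k) => [z|]; rewrite ?divr1 ?div1r.
  (* Since [0^-1 = 0], the value [w = 0] would put the infinite points at the origin. *)
  have n0 : \forall w \near (0 : K)^', w != 0 by exact: nbhs_dnbhs_neq.
  split.
    apply: filterS2 n0 (@nbhs_dnbhs K 0 _ Dnear) => w /coordE[-> ?] Dw.
    exact: DE.
  apply: cvg_trans (cvg_trans (cvg_fmap2 (@nbhs_dnbhs K 0)) Fcvg).
  by apply: near_eq_cvg; apply: filterS n0 => w /coordE[-> ?]; rewrite FE.
(* All points are finite here, so the default [0] never occurs and every denominator is [1]. *)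
have coordE : affine_coords x 0 = (fun k => hnum k / hdenom 0 k) /\
      forall k, hdenom 0 k != 0.
  split=> [|k].
    apply/funext => k; rewrite /affine_coords /hnum /hdenom.
    case E: (x k) => [z|]; first by rewrite divr1.
    by case: xfin; exists k; rewrite E.
  rewrite /hdenom; case E: (x k) => [z|]; first exact: oner_neq0.
  by case: xfin; exists k; rewrite E.
have [-> q0] := coordE; split; last exact: FE.
by apply: DE => //; exact: nbhs_singleton Dnear.
Qed.

End Limits.

(** * The determinant form and eigenvectors in dimension two *)

Section Area.
Variable K : fieldType.
Implicit Types (A B : 'M[K]_2) (u v w : 'cV[K]_2).

Lemma mulmx_cV2 A u r : (A *m u) r 0 = A r 0 * u 0 0 + A r 1 * u 1 0.
Proof.
by rewrite mxE !big_ord_recl big_ord0 addr0; congr (_ + A r _ * u _ 0);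
  exact: val_inj.
Qed.

Lemma scale_cV2 a u r : (a *: u) r 0 = a * u r 0.
Proof. by rewrite mxE. Qed.

Lemma cV2P u v : u 0 0 = v 0 0 -> u 1 0 = v 1 0 -> u = v.
Proof.
move=> uv0 uv1; apply/matrixP => r c; rewrite (ord1 c).
by case: r => [[|[|//]] r2]; [move: uv0|move: uv1];
  congr (u _ _ = v _ _); exact: val_inj.
Qed.

Lemma det_mx22 A : \det A = A 0 0 * A 1 1 - A 0 1 * A 1 0.
Proof.
rewrite (expand_det_row _ 0) !big_ord_recl big_ord0 addr0 /cofactor !det_mx11.
rewrite !mxE /= expr0 mul1r expr1 mulN1r mulrN.
by congr (_ * A _ _ - A _ _ * A _ _); exact: val_inj.
Qed.

Definition area u v : K := u 0 0 * v 1 0 - v 0 0 * u 1 0.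

Lemma area_mulmx A u v : area (A *m u) (A *m v) = \det A * area u v.
Proof. by rewrite det_mx22 /area !mulmx_cV2; ring. Qed.

Lemma areaZl a u v : area (a *: u) v = a * area u v.
Proof. by rewrite /area !mxE; ring. Qed.

Lemma areaZr a u v : area u (a *: v) = a * area u v.
Proof. by rewrite /area !mxE; ring. Qed.

(** Cramer's rule without division, hence valid for proportional [v] and [w] too. *)
Lemma area_cramer u v w : area v w *: u = area u w *: v + area v u *: w.
Proof. by apply: cV2P; rewrite !mxE /area; ring. Qed.

(** The zero vector is allowed; the applications are to the nonzero [cp1_vec p]. *)
Definition eigenvector A v := exists l, A *m v = l *: v.

Lemma eigenvector_mul A B v :
  eigenvector A v -> eigenvector B v -> eigenvector (A *m B) v.
Proof.
move=> [a Av] [b Bv]; exists (b * a).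
by rewrite -mulmxA Bv -scalemxAr Av scalerA.
Qed.

Lemma eigenvector_inv A v :
  A \in unitmx -> eigenvector A v -> eigenvector (invmx A) v.
Proof.
move=> Au [a Av]; exists a^-1.
have vE : v = a *: (invmx A *m v) by rewrite scalemxAr -Av mulKmx.
(* If [a = 0] then [vE] forces [v = 0], and both sides vanish. *)
have [a0|a0] := eqVneq a 0; last by rewrite {2}vE scalerA mulVf// scale1r.
by rewrite vE a0 scale0r mulmx0 scaler0.
Qed.

Lemma area_eigenvectors_eq0 A u v a :
  \det A = 1 -> A *m u = a *: u -> A *m v = a *: v -> a ^+ 2 != 1 -> area u v = 0.
Proof.
move=> A1 Au Av a2; have := area_mulmx A u v.
rewrite Au Av areaZl areaZr A1 mul1r => /eqP; rewrite mulrA -expr2.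
by rewrite -subr_eq0 -{2}[area u v]mul1r -mulrBl mulf_eq0 subr_eq0 (negPf a2) => /eqP.
Qed.

(** If [b] is the eigenvalue at [v], invariance of [area] gives [a * b * area u v = area u v], hence
    [a * b = 1]. *)
Lemma eigenvalue_inv A u v a :
  \det A = 1 -> area u v != 0 -> A *m u = a *: u -> eigenvector A v ->
  A *m v = a^-1 *: v.
Proof.
move=> A1 uv Au [b Av]; rewrite Av; congr (_ *: _).
have /eqP := area_mulmx A u v; rewrite Au Av areaZl areaZr A1 mulrA.
rewrite (inj_eq (mulIf uv)) => /eqP ab1.
have a0 : a != 0.
  by apply/eqP => a0; move/esym/eqP: ab1; rewrite a0 mul0r oner_eq0.
by rewrite -[LHS](mulKf a0) ab1 mulr1.
Qed.

End Area.

(** * Points of the projective line and their vectors *)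

Section Line.
Variable K : numClosedFieldType.
Implicit Types (A : 'M[K]_2) (p : CP1 K).

Lemma cp1_vec0 p : cp1_vec p 0 0 = if p is Some z then z else 1.
Proof. by rewrite mxE eqxx; case: p. Qed.

Lemma cp1_vec1 p : cp1_vec p 1 0 = if p is Some z then 1 else 0.
Proof. by rewrite mxE; case: p. Qed.

Lemma cp1_vec_neq0 p : cp1_vec p != 0.
Proof.
apply/eqP => p0; case: p p0 => [z|] /matrixP p0.
  by have /eqP := p0 1 0; rewrite cp1_vec1 mxE oner_eq0.
by have /eqP := p0 0 0; rewrite cp1_vec0 mxE oner_eq0.
Qed.

(** Turns a vanishing determinant into an equality of projective classes, which is how [y i] gets
    identified. *)
Lemma cp1_quot_vec p a b :
  (a, b) != (0, 0) -> cp1_vec p 0 0 * b = a * cp1_vec p 1 0 ->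
  cp1_quot a b = p.
Proof.
rewrite cp1_vec0 cp1_vec1 /cp1_quot => ab0; case: p => [z|].
  rewrite mulr1 => zb; move: ab0; rewrite -zb.
  by have [->|b0] := eqVneq b 0; rewrite ?mulr0 ?eqxx// mulfK.
by rewrite mulr0 mul1r => ->; rewrite eqxx.
Qed.

Lemma area_cp1_vec_neq0 p p' : p <> p' -> area (cp1_vec p) (cp1_vec p') != 0.
Proof.
move=> pp'; rewrite /area !cp1_vec0 !cp1_vec1; case: p p' pp' => [z|] [z'|] //=.
- by rewrite !mulr1 subr_eq0 => zz'; apply/eqP => ?; apply: zz'; congr Some.
- by rewrite mulr0 sub0r mulr1 oppr_eq0 oner_eq0.
- by rewrite mulr0 subr0 mulr1 oner_eq0.
Qed.

(** The eigenvalue is the denominator of the Möbius map at a finite point, and the upper left entry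
    at infinity. Conversely, invertibility makes it nonzero, which excludes the quotient of zero by
    zero. *)
Lemma mobius_fixedP A p : A \in unitmx ->
  mobius A p = p <-> eigenvector A (cp1_vec p).
Proof.
move=> Au; split.
  case: p => [z|] /=; rewrite /cp1_quot; case: eqVneq => // b0.
    case=> zE; exists (A 1 0 * z + A 1 1); apply: cV2P;
      rewrite mulmx_cV2 scale_cV2 cp1_vec0 cp1_vec1 !mulr1 //.
    by move/(canRL (divfK b0)): zE => ->; rewrite mulrC.
  move=> _; exists (A 0 0); apply: cV2P;
    by rewrite mulmx_cV2 scale_cV2 cp1_vec0 cp1_vec1 !mulr1 !mulr0 addr0.
case=> l Ap; have l0 : l != 0.
  apply/eqP => l0; have := cp1_vec_neq0 p.
  by rewrite -[cp1_vec p](mulKmx Au) Ap l0 scale0r mulmx0 eqxx.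
have E0 := congr1 (fun u : 'cV[K]_2 => u 0 0) Ap.
have E1 := congr1 (fun u : 'cV[K]_2 => u 1 0) Ap.
move: E0 E1; rewrite /= !mulmx_cV2 !scale_cV2 !cp1_vec0 !cp1_vec1.
case: p {Ap} => [z|] /=; rewrite /cp1_quot !mulr1 ?mulr0 ?addr0 => E0 E1.
  by rewrite E0 E1 (negPf l0) mulrC mulKf.
by rewrite E1 eqxx.
Qed.

End Line.

(** * The generators and irreducibility *)

Section Representation.
Variables (K : numClosedFieldType) (rho : {multiplicative pants_group -> SL2 K}).
Let M (i : 'Z_3) : 'M[K]_2 := SL2_mx (rho (pants_gen i)).

Lemma SL2_mx_det (A : SL2 K) : \det (SL2_mx A) = 1.
Proof. exact/eqP/(valP A). Qed.

Lemma rho1 : rho 1%g = 1%g.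
Proof. by apply: (@mulgI _ (rho 1%g)); rewrite -gmulfM !mulg1. Qed.

Lemma rhoV g : rho g^-1%g = (rho g)^-1%g.
Proof. by apply: (@mulgI _ (rho g)); rewrite -gmulfM !mulgV rho1. Qed.

(** The relation may be permuted cyclically, since a one-sided inverse of a square matrix is
    two-sided. *)
Lemma pants_mx_rel i : M i *m M (i + 1) *m M (i + 2) = 1%:M.
Proof.
have M123 : M 1 *m M 2 *m M 3 = 1%:M.
  have := congr1 (fun g => SL2_mx (rho g)) pants_gen_rel.
  by rewrite !gmulfM rho1.
have [->|[->|->]] : i = 1 \/ i = 2 \/ i = 3.
  by case: i => [[|[|[|//]]] ?]; [right; right|left|right; left]; exact: val_inj.
- exact: M123.
- have -> : 2 + 1 = 3 :> 'Z_3 by apply/eqP.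
  have -> : 2 + 2 = 1 :> 'Z_3 by apply/eqP.
  by apply: mulmx1C; rewrite mulmxA.
- have -> : 3 + 1 = 1 :> 'Z_3 by apply/eqP.
  have -> : 3 + 2 = 2 :> 'Z_3 by apply/eqP.
  by rewrite -mulmxA; apply: mulmx1C.
Qed.

(** Induction on a representing word: each letter is a generator or the inverse of one. *)
Lemma pants_gen_ind (P : pants_group -> Prop) :
  P 1%g -> (forall g h, P g -> P h -> P (g * h)%g) ->
  (forall g, P g -> P g^-1%g) -> (forall i, P (pants_gen i)) -> forall g, P g.
Proof.
move=> P1 PM PV Pgen g; have [u ->] := pants_repr g.
elim: u => [//|[i b] u IHu].
have -> : pants_class ((i, b) :: u)
    = (pants_class [:: (i, b)] * pants_class u)%g.
  by apply/esym; exact: pants_mulE.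
apply: PM IHu; case: b; last exact: Pgen.
have -> : pants_class [:: (i, true)] = ((pants_gen i)^-1)%g.
  by apply/esym; exact: pants_invE.
exact: PV.
Qed.

(** By the relation the third generator is the inverse of the product of the other two, so two
    generators fixing [p] force the whole image to fix it. *)
Lemma no_common_eigenvector i p : irreducible_rep rho ->
  eigenvector (M i) (cp1_vec p) -> eigenvector (M (i + 1)) (cp1_vec p) -> False.
Proof.
move=> irr Ei Ei1; apply: irr; exists p.
have detu (A : SL2 K) : SL2_mx A \in unitmx by exact: SL2_unitmx.
have Ei2 : eigenvector (M (i + 2)) (cp1_vec p).
  have -> : M (i + 2) = invmx (M i *m M (i + 1)).
    have Mu : M i *m M (i + 1) \in unitmx by rewrite unitmx_mul !detu.
    by rewrite -[LHS](mulKmx Mu) pants_mx_rel mulmx1.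
  by apply: eigenvector_inv; [rewrite unitmx_mul !detu|exact: eigenvector_mul].
suff E g : eigenvector (SL2_mx (rho g)) (cp1_vec p).
  by move=> g; rewrite /fixed_points /=; apply/mobius_fixedP; [exact: detu|exact: E].
elim/pants_gen_ind: g => [|g h Eg Eh|g Eg|j].
- by exists 1; rewrite rho1 scale1r mul1mx.
- by rewrite gmulfM; exact: eigenvector_mul.
- by rewrite rhoV; apply: eigenvector_inv; [exact: detu|].
have [->|[->|->]] // : j = i \/ j = i + 1 \/ j = i + 2.
clear; move: i j => [[|[|[|//]]] ?] [[|[|[|//]]] ?];
  by [left; exact: val_inj|right; left; exact: val_inj|right; right; exact: val_inj].
Qed.

End Representation.

(** * The generators and their second fixed points in terms of the [e i] and [x i] *)

Section PantsRepresentation.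
Variables (K : numClosedFieldType) (rho : {multiplicative pants_group -> SL2 K}).
Variables (x y : 'Z_3 -> CP1 K) (e : 'Z_3 -> K).
Let M (i : 'Z_3) : 'M[K]_2 := SL2_mx (rho (pants_gen i)).
Let v (i : 'Z_3) : 'cV[K]_2 := cp1_vec (x i).
Hypothesis rho_irr : irreducible_rep rho.
Hypothesis xy_neq : forall i, x i <> y i.
Hypothesis y_fixed : forall i, fixed_points (M i) (y i).
Hypothesis e_eigen : forall i, M i *m v i = e i *: v i.

Let p := hnum x.
Let q := hdenom x 0.

Let pE k : v k 0 0 = p k. Proof. exact: cp1_vec0. Qed.
Let qE k : v k 1 0 = q k. Proof. exact: cp1_vec1. Qed.

Lemma eigen_neq0 i : e i != 0.
Proof.
apply/eqP => e0; have := cp1_vec_neq0 (x i).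
rewrite -[cp1_vec _](mulKmx (SL2_unitmx (rho (pants_gen i)))).
by rewrite [X in _ *m X]e_eigen e0 scale0r mulmx0 eqxx.
Qed.

(** If [x i] and [x (i + 1)] coincided, two generators would share a fixed point, against
    irreducibility. *)
Lemma area_succ_neq0 i : area (v i) (v (i + 1)) != 0.
Proof.
apply: area_cp1_vec_neq0 => xE.
apply: (@no_common_eigenvector _ rho i (x i)) => //; first by exists (e i); exact: e_eigen.
by rewrite xE; exists (e (i + 1)); exact: e_eigen.
Qed.

Lemma bracketE j k : bracket p q j k = area (v j) (v k).
Proof. by rewrite /bracket /area !pE !qE. Qed.

Lemma bracketC j k : bracket p q j k = - bracket p q k j.
Proof. by rewrite /bracket opprB. Qed.

Lemma hden_neq0 i : hden e p q i != 0.
Proof.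
rewrite /hden bracketC !mulf_neq0 ?eigen_neq0 ?oppr_eq0// bracketE.
  exact: area_succ_neq0.
(* The pair [i + 2], [i] is also consecutive, because [3 = 0] in ['Z_3]. *)
have := area_succ_neq0 (i + 2); rewrite -addrA.
have -> : 2 + 1 = 0 :> 'Z_3 by apply/eqP.
by rewrite addr0.
Qed.

Lemma eigen_inv_y i : M i *m cp1_vec (y i) = (e i)^-1 *: cp1_vec (y i).
Proof.
apply: (@eigenvalue_inv _ _ (v i)) => //.
- exact: SL2_mx_det.
- exact: area_cp1_vec_neq0.
- by apply/mobius_fixedP; [exact: SL2_unitmx|exact: y_fixed].
Qed.

Lemma eigen_sqr_neq1 i : e i ^+ 2 != 1.
Proof.
apply/eqP => e2.
have eV : (e i)^-1 = e i.
  by rewrite -[LHS]mul1r -e2 expr2 mulfK ?eigen_neq0.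
have My : M i *m cp1_vec (y i) = e i *: cp1_vec (y i).
  by rewrite -[in RHS]eV; exact: eigen_inv_y.
apply: (@no_common_eigenvector _ rho i (x (i + 1))) => //; last first.
  by exists (e (i + 1)); exact: e_eigen.
exists (e i); set u := cp1_vec _.
have xy0 := area_cp1_vec_neq0 (xy_neq (i := i)).
(* If [e i ^+ 2 = 1] then [M i] is scalar, so it also fixes [x (i + 1)]. *)
have uE := area_cramer u (v i) (cp1_vec (y i)).
apply: (scalerI xy0); rewrite scalemxAr uE mulmxDr -!scalemxAr e_eigen My.
by rewrite [RHS]scalerA [X in X *: u]mulrC -scalerA uE scalerDr !scalerA
  ![e i * _]mulrC.
Qed.

Lemma area_gen_succ i :
  e i * area (v i) (M i *m v (i + 1)) = area (v i) (v (i + 1)).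
Proof. by rewrite -areaZl -e_eigen area_mulmx SL2_mx_det mul1r. Qed.

(** The relation writes [v (i + 1)] as [e (i + 1)] times the image of [M i *m v (i + 1)] under
    [M (i + 2)], which preserves [area] and scales [v (i + 2)] by [e (i + 2)]. *)
Lemma area_gen_succ2 i :
  e (i + 1) * area (v (i + 2)) (M i *m v (i + 1))
  = e (i + 2) * area (v (i + 2)) (v (i + 1)).
Proof.
have rel : M (i + 2) *m M i *m M (i + 1) = 1%:M.
  by rewrite -mulmxA; apply/mulmx1C/pants_mx_rel.
have vE : v (i + 1) = e (i + 1) *: (M (i + 2) *m (M i *m v (i + 1))).
  by rewrite -[LHS]mul1mx -rel -!mulmxA e_eigen -!scalemxAr.
rewrite [X in _ = _ * area _ X]vE areaZr mulrCA; congr (_ * _).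
by rewrite -areaZl -e_eigen area_mulmx SL2_mx_det mul1r.
Qed.

Lemma hden_gen i :
  [/\ hden e p q i * M i 0 0 = ha11 e p q i,
      hden e p q i * M i 0 1 = - (p i * hynum e p q i),
      hden e p q i * M i 1 0 = q i * hyden e p q i
    & hden e p q i * M i 1 1 = ha22 e p q i].
Proof.
apply: coord_of_area.
- by rewrite -pE -qE -mulmx_cV2 e_eigen mxE.
- by rewrite -pE -qE -mulmx_cV2 e_eigen mxE.
- by have := area_gen_succ i; rewrite /area !mulmx_cV2 !pE !qE.
- by have := area_gen_succ2 i; rewrite /area !mulmx_cV2 !pE !qE.
Qed.

Lemma hmx_gen i : hmx e p q i = M i.
Proof.
have [h11 h12 h21 h22] := hden_gen i.
rewrite /hmx -h11 -h12 -h21 -h22; apply/matrixP => r c; rewrite !mxE.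
have D0 := hden_neq0 i.
by case: r => [[|[|//]] r2]; case: c => [[|[|//]] c2] /=; rewrite mulKf//;
  congr (M i _ _); exact: val_inj.
Qed.

Let Y i : 'cV[K]_2 := \col_r (if r == 0 then hynum e p q i else hyden e p q i).

(** [Y i] is a combination of [v (i + 1)], [v (i + 2)] and [v i]; the last term drops out, and the
    other two share all factors but [e i ^+ 2] and [-1]. *)
Lemma area_x_Y i : area (v i) (Y i)
  = e (i + 1) * bracket p q i (i + 2) * bracket p q i (i + 1) * (e i ^+ 2 - 1).
Proof. by rewrite /area pE qE !mxE /= /hynum /hyden /bracket; ring. Qed.

Lemma Y_neq0 i : area (v i) (Y i) != 0.
Proof.
rewrite area_x_Y; have := hden_neq0 i.
rewrite /hden bracketC [bracket _ _ (i + 2) _]bracketC !mulf_eq0 !oppr_eq0 !negb_or.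
move=> /andP[/andP[/andP[_ ->] ->] ->] /=.
by rewrite subr_eq0 eigen_sqr_neq1.
Qed.

Lemma eigen_inv_Y i : M i *m Y i = (e i)^-1 *: Y i.
Proof.
have [h11 h12 h21 h22] := hden_gen i.
have D0 := hden_neq0 i; have e0 := eigen_neq0 i.
(* Multiplying by [hden e p q i * e i] removes [(e i)^-1] and makes the matrix entries polynomial,
   so [ring] can conclude. *)
have De0 := mulf_neq0 D0 e0.
apply: cV2P; rewrite mulmx_cV2 scale_cV2 !mxE /=.
- apply: (mulfI De0).
  transitivity (e i * ((hden e p q i * M i 0 0) * hynum e p q i
    + (hden e p q i * M i 0 1) * hyden e p q i)); first by ring.
  rewrite h11 h12.
  rewrite [RHS](_ : _ = hden e p q i * hynum e p q i); last by field.
  by rewrite /ha11 /hynum /hyden /hden /bracket; ring.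
- apply: (mulfI De0).
  transitivity (e i * ((hden e p q i * M i 1 0) * hynum e p q i
    + (hden e p q i * M i 1 1) * hyden e p q i)); first by ring.
  rewrite h21 h22.
  rewrite [RHS](_ : _ = hden e p q i * hyden e p q i); last by field.
  by rewrite /ha22 /hynum /hyden /hden /bracket; ring.
Qed.

Lemma hy_neq0 i : (hynum e p q i, hyden e p q i) != (0, 0).
Proof.
apply: contraNneq (Y_neq0 i) => -[n0 d0].
by rewrite /area !mxE /= n0 d0 mulr0 mul0r subrr.
Qed.

Lemma cp1_quot_y i : cp1_quot (hynum e p q i) (hyden e p q i) = y i.
Proof.
have yY : area (cp1_vec (y i)) (Y i) = 0.
  apply: (@area_eigenvectors_eq0 _ (M i) _ _ (e i)^-1).
  - exact: SL2_mx_det.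
  - exact: eigen_inv_y.
  - exact: eigen_inv_Y.
  - by rewrite exprVn invr_eq1 eigen_sqr_neq1.
apply: cp1_quot_vec; first exact: hy_neq0.
by move/eqP: yY; rewrite /area subr_eq0 !mxE /= => /eqP.
Qed.

Lemma formula_value_mx i :
  formula_value [set z | pants_den e z i != 0] (fun z => pants_mx e z i) x (M i).
Proof.
rewrite -hmx_gen.
apply: (@formula_value_homogeneous _ x _ _ _
  (fun p q => hden e p q i != 0) (fun p q => hmx e p q i)).
- by move=> p' q' q0; exact: pants_mx_quot.
- by move=> p' q' q0 D0 /=; rewrite pants_den_quot// mulf_neq0// invr_eq0 !mulf_neq0 ?expf_neq0.
- have Dcvg := @cvg_hden _ _ _ (@nbhs_filter _ (0 : K)) e p i _ _ (@cvg_hdenom K x).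
  exact: (@cvgr_neq0 K (K : numFieldType) _ _ _ _ _ Dcvg (hden_neq0 i)).
- exact: (@cvg_hmx _ _ _ (@nbhs_filter _ (0 : K)) e p i _ _
    (@cvg_hdenom K x) (hden_neq0 i)).
Qed.

Lemma formula_value_y i :
  formula_value [set z | (pants_ynum e z i, pants_yden e z i) != (0, 0)]
    (fun z => cp1_quot (pants_ynum e z i) (pants_yden e z i)) x (y i).
Proof.
rewrite -cp1_quot_y.
have ncvg := @cvg_hynum _ _ _ (@nbhs_filter _ (0 : K)) e p i _ _ (@cvg_hdenom K x).
have dcvg := @cvg_hyden _ _ _ (@nbhs_filter _ (0 : K)) e p i _ _ (@cvg_hdenom K x).
apply: (@formula_value_homogeneous _ x _ _ _
  (fun p q => (hynum e p q i, hyden e p q i) != (0, 0))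
  (fun p q => cp1_quot (hynum e p q i) (hyden e p q i))).
- by move=> p' q' q0; exact: cp1_quot_quot.
- move=> p' q' q0 /=; rewrite pants_ynum_quot// pants_yden_quot//.
  by rewrite !xpair_eqE !mulf_eq0 !invr_eq0 !mulf_eq0 !(negPf (q0 _)) !orbF.
(* Whichever coordinate is nonzero at [w = 0] stays nonzero nearby, by continuity. *)
- have := hy_neq0 i; rewrite xpair_eqE negb_and => /orP[n0|d0].
    have := @cvgr_neq0 K (K : numFieldType) _ _ (@nbhs_filter _ (0 : K)) _ _ ncvg n0.
    by apply: filterS => w wn; rewrite xpair_eqE negb_and wn.
  have := @cvgr_neq0 K (K : numFieldType) _ _ (@nbhs_filter _ (0 : K)) _ _ dcvg d0.
  by apply: filterS => w wd; rewrite xpair_eqE negb_and wd orbT.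
- exact: (@cvg_cp1_quot K K _ (@nbhs_filter _ (0 : K)) _ _ _ _ ncvg dcvg (hy_neq0 i)).
Qed.

End PantsRepresentation.

Unset Implicit Arguments.

Theorem proposition3p1 (R : realType)
    (rho : {multiplicative pants_group -> SL2 (Cplx R)})
    (x y : 'Z_3 -> CP1 (Cplx R)) (e : 'Z_3 -> Cplx R)
    (rho_irr : irreducible_rep rho)
    (xy_neq : forall i, x i <> y i)
    (xy_fixed : forall i,
       fixed_points (SL2_mx (rho (pants_gen i))) = [set x i; y i])
    (e_eigen : forall i,
       SL2_mx (rho (pants_gen i)) *m cp1_vec (x i) = e i *: cp1_vec (x i)) :
  forall i : 'Z_3,
    [/\ formula_value [set z | pants_den e z i != 0]
          (fun z => pants_mx e z i) x (SL2_mx (rho (pants_gen i))),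
        formula_value [set z | (pants_ynum e z i, pants_yden e z i) != (0, 0)]
          (fun z => cp1_quot (pants_ynum e z i) (pants_yden e z i)) x (y i)
      & SL2_mx (rho (pants_gen i)) *m cp1_vec (y i)
          = (e i)^-1 *: cp1_vec (y i)].
Proof.
have y_fixed i : fixed_points (SL2_mx (rho (pants_gen i))) (y i).
  by rewrite xy_fixed; right.
move=> i; split.
- exact: (formula_value_mx rho_irr e_eigen).
- exact: (formula_value_y rho_irr xy_neq y_fixed e_eigen).
- exact: (eigen_inv_y xy_neq y_fixed e_eigen).
Qed.
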